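(* Let $(X,\|\cdot\|)$ be an AM-space with unit, denoted by $e$, and let $F:X\to X$ be additively homogeneous ($F(x+te)=F(x)+te$ for all $x\in X$, $t\in\mathbb R$) and order preserving ($x\le y$ implies $F(x)\le F(y)$). Let $S=\{x\in X\mid F(x)=x\}$, and assume that $v\in S$. Assume: (A1) $F$ is semidifferentiable at $v$, with semidifferential $F'_v:X\to X$; (A2) the map $\mathrm{Id}-F'_v:X\to X$ has Property (F); (A3) if $F'_v(x)=x$ for some $x\in X$, then $x\in\{\lambda e\mid\lambda\in\mathbb R\}$. Then $S=\{v+\lambda e\mid\lambda\in\mathbb R\}$.
   Context: AM-space with unit: a (real) Banach lattice $(X,\|\cdot\|,\le)$ equipped with a distinguished element $e\ge0$ (the unit) such that $\|x\|=\inf\{a\ge0\mid -ae\le x\le ae\}$ for all $x\in X$ (equivalently, up to isometric lattice isomorphism, $X=\mathscr C(K)$ with the sup-norm for a compact Hausdorff space $K$, with $e$ the constant function $1$). Semidifferentiability: let $G\subset X$ and $v$ an interior point of $G$. A map $F:G\to X$ is semidifferentiable at $v$ if there exists a continuous, positively homogeneous map $h:X\to X$ (i.e. $h(tx)=th(x)$ for all $t>0$, $x\in X$) such that $F(v+x)=F(v)+h(x)+o(\|x\|)$ as $x\to0$. Such $h$ is unique and denoted $F'_v$ (the semidifferential of $F$ at $v$). Property (F): a map $g:D\to Y$, with $D\subset X$ and $X,Y$ Banach spaces, has Property (F) if every sequence $(x_j)_{j\ge1}$ in $D$ that is bounded in $X$ and satisfies $g(x_j)\to0$ has a subsequence that converges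 in $X$. *)

(* Defs.v *)
From HB Require Import structures.
From mathcomp Require Import all_boot all_order all_algebra.
From mathcomp Require Import all_classical all_reals all_analysis.
Set Implicit Arguments.
Unset Strict Implicit.
Unset Printing Implicit Defensive.
Import Order.TTheory GRing.Theory Num.Theory.
Import numFieldNormedType.Exports.
Local Open Scope classical_set_scope.
Local Open Scope ring_scope.

(* The order is a separate operation [ble]: Hierarchy Builder rejects the join
   of [CompleteNormedModule] with the structures of [order.v], because ordered
   fields already inherit from both an order and a [zmodType].
   [bjoin x (- x)] is the lattice absolute value of [x]; [`|x|] is the norm. *)
HB.mixin Record isBanachLattice (R : realType) X
    of CompleteNormedModule R X := {
  ble : rel X;
  bjoin : X -> X -> X;
  bmeet : X -> X -> X;
  ble_refl : reflexive ble;
  ble_anti : antisymmetric ble;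
  ble_trans : transitive ble;
  bjoinP : forall x y z : X, ble (bjoin x y) z = ble x z && ble y z;
  bmeetP : forall x y z : X, ble z (bmeet x y) = ble z x && ble z y;
  ble_add2r : forall x y z : X, ble x y -> ble (x + z) (y + z);
  ble_scale : forall (a : R) (x : X), 0 <= a -> ble 0 x -> ble 0 (a *: x);
  ble_norm : forall x y : X,
    ble (bjoin x (- x)) (bjoin y (- y)) -> `|x| <= `|y|
}.

#[short(type="banachLatticeType")]
HB.structure Definition BanachLattice (R : realType) :=
  { X of isBanachLattice R X & CompleteNormedModule R X }.

Notation "x [<=] y" := (ble x y) (at level 70, no associativity).

(* [inf] of the empty set is 0 here, rather than +oo.  This changes nothing:
   a nonzero [x] has nonzero norm, so its set is nonempty, and the set of
   [x = 0] contains 0. *)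
Definition AM_unit (R : realType) (X : banachLatticeType R) (e : X) : Prop :=
  0 [<=] e /\
  forall x : X, `|x| = inf [set a : R | [/\ 0 <= a, - (a *: e) [<=] x & x [<=] a *: e]].

Definition additively_homogeneous (R : realType) (X : normedModType R)
    (e : X) (F : X -> X) : Prop :=
  forall (x : X) (t : R), F (x + t *: e) = F x + t *: e.

Definition order_preserving (R : realType) (X : banachLatticeType R)
    (F : X -> X) : Prop :=
  {homo F : x y / x [<=] y}.

Definition positively_homogeneous (R : realType) (X : normedModType R)
    (h : X -> X) : Prop :=
  forall (t : R) (x : X), 0 < t -> h (t *: x) = t *: h x.

(* The map [F : G -> X] is represented by a total function; its values outside
   [G] are irrelevant because [v] is interior to [G]. *)
Definition is_semidifferential (R : realType) (X : normedModType R)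
    (G : set X) (F : X -> X) (v : X) (h : X -> X) : Prop :=
  [/\ interior G v, continuous h, positively_homogeneous h
    & (fun x : X => F (v + x) - (F v + h x)) =o_ (0 : X) id].

(* Only the values of [g] on [D] matter. *)
Definition property_F (R : realType) (X Y : completeNormedModType R)
    (D : set X) (g : X -> Y) : Prop :=
  forall u : nat -> X,
    (forall j, D (u j)) -> bounded_set (range u) ->
    g (u j) @[j --> \oo] --> (0 : Y) ->
    exists k : nat -> nat, increasing_seq k /\ cvgn (u \o k).

(* Main.v *)
Require Import Defs.
From HB Require Import structures.
From mathcomp Require Import all_boot all_order all_algebra.
From mathcomp Require Import all_classical all_reals all_analysis.
Set Implicit Arguments.
Unset Strict Implicit.
Unset Printing Implicit Defensive.
Import Order.TTheory GRing.Theory Num.Theory.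
Import numFieldNormedType.Exports.
Local Open Scope classical_set_scope.
Local Open Scope ring_scope.

(* Let w be a fixed point with w - v not a multiple of e.  Adding a multiple of
   e to w, one may assume that z = w - v is >= 0 but dominates no d e with d > 0
   (in C(K): min z = 0).  Put M = |z|.  For 0 < t <= M the order interval
     [v \/ (w - (M - t) e), (v + t e) /\ w]
   is F-invariant, and |x - v| = t for every x in it.  As F is nonexpansive, it
   has approximate fixed points x in this interval with residual o(t), and then
   y = (x - v) / t satisfies y - F'_v(y) -> 0 as t -> 0.  By (A2) and (A3), the
   y's accumulate at some l e >= 0 of norm 1.  But t y <= z forces l <= 0. *)

(** * Order arithmetic and the Archimedean property *)

Section BanachLattice.
Context (R : realType) (X : banachLatticeType R).
Implicit Types (x y z : X) (a b : R).

Lemma bleD2r z x y : (x + z [<=] y + z) = (x [<=] y).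
Proof.
apply/idP/idP => [|/ble_add2r//].
by move=> /(@ble_add2r _ _ _ _ (- z)); rewrite !addrK.
Qed.

Lemma bsubr_ge0 x y : (0 [<=] y - x) = (x [<=] y).
Proof. by rewrite -(bleD2r x) add0r subrK. Qed.

Lemma ble_subl_addr x y z : (x - y [<=] z) = (x [<=] z + y).
Proof. by rewrite -(bleD2r y) subrK. Qed.

Lemma ble_subr_addr x y z : (x [<=] y - z) = (x + z [<=] y).
Proof. by rewrite -(bleD2r z) subrK. Qed.

Lemma bleN2 x y : (- x [<=] - y) = (y [<=] x).
Proof. by rewrite -bsubr_ge0 opprK addrC bsubr_ge0. Qed.

Lemma bleN0 x : (- x [<=] 0) = (0 [<=] x).
Proof. by rewrite -bleN2 opprK oppr0. Qed.

Lemma ble_scale2l a x y : 0 <= a -> x [<=] y -> a *: x [<=] a *: y.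
Proof.
by move=> a0 xy; rewrite -bsubr_ge0 -scalerBr ble_scale// bsubr_ge0.
Qed.

Lemma ble_scale2r x a b : 0 [<=] x -> a <= b -> a *: x [<=] b *: x.
Proof.
by move=> x0 ab; rewrite -bsubr_ge0 -scalerBl ble_scale// subr_ge0.
Qed.

Lemma ble_joinl x y : x [<=] bjoin x y.
Proof. by have := ble_refl (bjoin x y); rewrite bjoinP => /andP[]. Qed.

Lemma ble_joinr x y : y [<=] bjoin x y.
Proof. by have := ble_refl (bjoin x y); rewrite bjoinP => /andP[]. Qed.

Lemma ble_meetl x y : bmeet x y [<=] x.
Proof. by have := ble_refl (bmeet x y); rewrite bmeetP => /andP[]. Qed.

Lemma ble_meetr x y : bmeet x y [<=] y.
Proof. by have := ble_refl (bmeet x y); rewrite bmeetP => /andP[]. Qed.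

Lemma bjoin_ge0N x : 0 [<=] x -> bjoin x (- x) = x.
Proof.
move=> x0; apply: ble_anti; rewrite ble_joinl bjoinP ble_refl /= andbT.
by apply: (@ble_trans _ _ 0) => //; rewrite bleN0.
Qed.

Lemma ble_norm_ge0 x y : 0 [<=] x -> x [<=] y -> `|x| <= `|y|.
Proof.
move=> x0 xy; apply: ble_norm; rewrite !bjoin_ge0N//.
exact: ble_trans xy.
Qed.

(** The positive part of [x] lies below [a] times that of [z], so by monotonicity of the norm its
    norm is at most [a] times a constant for every [a > 0], hence zero. *)
Lemma ble_archimedean x z :
  (forall a, 0 < a -> x [<=] a *: z) -> x [<=] 0.
Proof.
move=> xz; suff /eqP <- : bjoin x 0 == 0 by exact: ble_joinl.
rewrite -normr_le0; apply/ler_addgt0Pl => d d0; rewrite addr0.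
pose a := d / (1 + `|bjoin z 0|).
have y1 : 0 < 1 + `|bjoin z 0| by rewrite ltr_wpDr.
have a0 : 0 < a by rewrite divr_gt0.
apply: (@le_trans _ _ `|a *: bjoin z 0|).
  apply: ble_norm_ge0; first exact: ble_joinr.
  rewrite bjoinP; apply/andP; split; last first.
    by apply: ble_scale (ltW a0) _; exact: ble_joinr.
  by apply: ble_trans (xz _ a0) _; rewrite ble_scale2l ?(ltW a0)// ble_joinl.
by rewrite normrZ gtr0_norm// mulrAC ler_pdivrMr// ler_pM2l// lerDr.
Qed.

End BanachLattice.

(** * The unit: bounds by multiples of [e] and by the norm *)

Section AMUnit.
Context (R : realType) (X : banachLatticeType R) (e : X) (he : AM_unit e).
Implicit Types (x y z : X) (a b t : R).

Let e0 : 0 [<=] e := he.1.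

Lemma AM_norm_le x a : 0 <= a ->
  - (a *: e) [<=] x -> x [<=] a *: e -> `|x| <= a.
Proof.
move=> a0 xa ax; rewrite he.2; apply: ge_inf; last by split.
by exists 0 => b [].
Qed.

Lemma AM_norm_ge0_le x a : 0 <= a -> 0 [<=] x -> x [<=] a *: e -> `|x| <= a.
Proof.
move=> a0 x0; apply: AM_norm_le => //; apply: (@ble_trans _ _ 0) => //.
by rewrite bleN0 ble_scale.
Qed.

Lemma AM_norm_lt x a : `|x| < a -> x [<=] a *: e.
Proof.
have [->|x0] := eqVneq x 0.
  by rewrite normr0 => a0; exact: (ble_scale _ _ (ltW a0)).
rewrite he.2 => /inf_lt[|b [b0 _ xb] ba].
  (* The infimum of the empty set is 0 by convention, so an empty set of bounds would force
     [x = 0]. *)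
  apply/set0P/eqP => S0; move: (he.2 x); rewrite S0 inf0 => /eqP.
  by rewrite normr_eq0 (negbTE x0).
by apply: ble_trans xb _; exact: ble_scale2r (ltW ba).
Qed.

(** The infimum defining the norm is attained: the bound holds up to every [a *: e] with [a > 0],
    and the Archimedean property removes this error. *)
Lemma AM_ble_norm x : x [<=] `|x| *: e.
Proof.
rewrite -bsubr_ge0 -bleN2 oppr0 opprB.
apply: (@ble_archimedean _ _ _ e) => a a0.
by rewrite ble_subl_addr -scalerDl AM_norm_lt// ltrDr.
Qed.

Lemma AM_ble_dist x y : x [<=] y + `|x - y| *: e.
Proof. by rewrite addrC -ble_subl_addr AM_ble_norm. Qed.

Lemma closed_ble_ge x : closed [set y | x [<=] y].
Proof.
move=> y cly /=; rewrite -bsubr_ge0 -bleN2 oppr0 opprB.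
apply: (@ble_archimedean _ _ _ e) => a a0.
have [z [/= xz]] := cly _ (nbhsx_ballx y a a0).
rewrite -ball_normE /= distrC => zy.
rewrite ble_subl_addr; apply: ble_trans xz _.
by rewrite -ble_subl_addr AM_norm_lt.
Qed.

Lemma closed_ble_le x : closed [set y | y [<=] x].
Proof.
rewrite (_ : [set y | _] = -%R @^-1` [set y | - x [<=] y]).
  by apply: closed_comp => [y _|]; [exact: opp_continuous|exact: closed_ble_ge].
by apply/seteqP; split => y /=; rewrite bleN2.
Qed.

(* In C(K), this subtracts its minimum from a nonconstant function [z]. *)
Lemma AM_normalize z : ~ (exists l, z = l *: e) ->
  exists c, 0 [<=] z + c *: e /\
    forall d, 0 < d -> ~ d *: e [<=] z + c *: e.
Proof.
(* As [u >= 0], its norm is its least upper multiple of [e] (its maximum in C(K)), so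
   [|u| *: e - u], which is [z + c *: e], has infimum 0. *)
move=> zNe; pose u := `|z| *: e - z; pose c := `|u| - `|z|.
have zc : z + c *: e = `|u| *: e - u.
  by rewrite /c scalerBl /u opprB addrC -!addrA (addrC (- _)).
have u0 : 0 [<=] u by rewrite bsubr_ge0 AM_ble_norm.
have nu0 : 0 < `|u|.
  rewrite lt_def normr_ge0 andbT normr_eq0; apply/eqP => uz.
  by apply: zNe; exists `|z|; apply/esym/eqP; rewrite -subr_eq0 -/u uz.
exists c; rewrite zc bsubr_ge0 AM_ble_norm; split => // d d0.
(* Shrinking [d] keeps the coefficient [|u| - d] nonnegative, so that it bounds the norm of [u]. *)
wlog du : d d0 / d <= `|u|.
  move=> H dz; apply: (H (Num.min d `|u|)).
  - by rewrite lt_min d0.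
  - by rewrite ge_min lexx orbT.
  - by apply: ble_trans dz; apply: ble_scale2r => //; rewrite ge_min lexx.
rewrite ble_subr_addr addrC -ble_subr_addr -scalerBl => ud.
suff : `|u| <= `|u| - d by rewrite lerDl oppr_ge0 leNgt d0.
by apply: AM_norm_ge0_le => //; rewrite subr_ge0.
Qed.

(** * Approximate fixed points of monotone homogeneous maps *)

Section HomogeneousMonotone.
Context (F : X -> X) (hadd : additively_homogeneous e F)
  (hmon : order_preserving F).

(** Apply [F] to [x <= y + |x - y| e], pull the multiple of [e] out, and exchange [x] and [y]. *)
Lemma homogeneous_monotone_nonexpansive x y : `|F x - F y| <= `|x - y|.
Proof.
have H u w : F u - F w [<=] `|u - w| *: e.
  by rewrite ble_subl_addr addrC -hadd hmon// AM_ble_dist.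
by apply: AM_norm_le => //; rewrite -bleN2 opprK opprB distrC.
Qed.

(** The map [(1 - r) F + r x] is a contraction of the closed order interval from [x] to [y]. Its
    fixed point [p] satisfies [p - F p = r (x - F p)], and [F p] lies in the interval. *)
Lemma approximate_fixed_point x y r : 0 < r -> r <= 1 -> x [<=] y ->
    x [<=] F x -> F y [<=] y ->
  exists p, [/\ x [<=] p, p [<=] y & `|p - F p| <= r * `|y - x|].
Proof.
move=> r0 r1 xy xFx Fyy.
pose U := [set p | x [<=] p] `&` [set p | p [<=] y].
pose g p := F p + r *: (x - F p).
have FU p : U p -> U (F p).
  case=> /= /hmon xp /hmon py.
  by split; [exact: ble_trans xp|exact: ble_trans Fyy].
have gU : set_fun U U g.
  move=> p /FU [/= xp py]; rewrite /g; split => /=.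
    rewrite -bsubr_ge0 (_ : _ - x = (1 - r) *: (F p - x)).
      by rewrite ble_scale ?subr_ge0// bsubr_ge0.
    by rewrite scalerBl scale1r addrAC -[x - F p]opprB scalerN.
  apply: ble_trans py.
  rewrite -bsubr_ge0 opprD addrA subrr add0r -scalerN opprB ble_scale ?(ltW r0)//.
  by rewrite bsubr_ge0.
have q0 : 0 <= 1 - r by rewrite subr_ge0.
have gctr : is_contraction (mkfun_fun gU).
  exists (NngNum q0); split => /=; first by rewrite gtrBl.
  case=> p q _ /=.
  rewrite (_ : g p - g q = (1 - r) *: (F p - F q)).
    rewrite normrZ ger0_norm// ler_wpM2l//.
    exact: homogeneous_monotone_nonexpansive.
  rewrite [RHS]scalerBl scale1r /g opprD addrACA -scalerBr -scalerN.
  by congr (_ + _ *: _); rewrite !opprB addrC addrA subrK.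
have [||p [/= xp py] gp] := banach_fixed_point gctr.
- by apply: closedI; [exact: closed_ble_ge|exact: closed_ble_le].
- by exists x; split => //=; exact: ble_refl.
have [/= xFp Fpy] : U (F p) by exact: FU.
exists p; split => //; rewrite [X in X - _]gp /= /g addrAC subrr add0r.
rewrite normrZ gtr0_norm// ler_pM2l// distrC.
by apply: ble_norm_ge0; rewrite ?bsubr_ge0// bleD2r.
Qed.

(** All of [v], [w], [v + t e], [w - c e] are fixed by [F], so the join [a] of two of them satisfies
    [a <= F a] and the meet [b] of the other two satisfies [F b <= b]. The bound
    [w <= v + (c + t) e] is what gives [a <= b], and [b - a <= t e] bounds the residual. *)
Lemma approximate_fixed_point_between v w c t r :
    0 < r -> r <= 1 -> 0 <= c -> 0 <= t -> F v = v -> F w = w ->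
    v [<=] w -> w [<=] v + (c + t) *: e ->
  exists p, [/\ v [<=] p, p [<=] v + t *: e, p [<=] w,
    w - c *: e [<=] p & `|p - F p| <= r * t].
Proof.
move=> r0 r1 c0 t0 Fv Fw vw wv.
pose a := bjoin v (w - c *: e); pose b := bmeet (v + t *: e) w.
have vt : v [<=] v + t *: e by rewrite addrC -bsubr_ge0 addrK ble_scale.
have wc : w - c *: e [<=] w.
  by rewrite ble_subl_addr addrC -bsubr_ge0 addrK ble_scale.
have wct : w - c *: e [<=] v + t *: e.
  by rewrite ble_subl_addr -addrA -scalerDl [t + c]addrC.
have va : v [<=] a by exact: ble_joinl.
have bv : b [<=] v + t *: e by exact: ble_meetl.
have ab : a [<=] b by rewrite bjoinP !bmeetP vt vw wct wc.
have aFa : a [<=] F a.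
  rewrite bjoinP; apply/andP; split; first by rewrite -{1}Fv; apply: hmon.
  rewrite -[X in X - _]Fw -scaleNr -hadd scaleNr; apply: hmon.
  exact: ble_joinr.
have Fbb : F b [<=] b.
  rewrite bmeetP; apply/andP; split; first by rewrite -Fv -hadd; apply: hmon.
  by rewrite -[X in _ [<=] X]Fw; apply: hmon; exact: ble_meetr.
have [p [ap pb pF]] := approximate_fixed_point r0 r1 ab aFa Fbb.
exists p; split.
- exact: ble_trans ap.
- exact: ble_trans bv.
- by apply: ble_trans pb _; exact: ble_meetr.
- by apply: ble_trans ap; exact: ble_joinr.
- apply: le_trans pF _; rewrite ler_pM2l//.
  apply: AM_norm_ge0_le => //; first by rewrite bsubr_ge0.
  by rewrite ble_subl_addr addrC; apply: ble_trans bv _; rewrite bleD2r.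
Qed.

End HomogeneousMonotone.
End AMUnit.

(** By homogeneity of [h], the residual of [y] is that of [x] divided by [t], plus the
    semidifferential error divided by [t]. The first is at most [r]; the second vanishes because
    [|x - v| <= t]. *)
Lemma semidifferential_residual (R : realType) (X : normedModType R)
    (F h : X -> X) (v : X) (x : nat -> X) (t r : nat -> R) :
    F v = v -> is_semidifferential [set: X] F v h ->
    (forall n, 0 < t n) -> t n @[n --> \oo] --> 0 -> r n @[n --> \oo] --> 0 ->
    (forall n, `|x n - v| <= t n) ->
    (forall n, `|x n - F (x n)| <= r n * t n) ->
  let y n := (t n)^-1 *: (x n - v) in y n - h (y n) @[n --> \oo] --> (0 : X).
Proof.
move=> Fv [_ _ hpos /eqoP Fo] t0 tcvg rcvg xv xF y.
have xv0 : x n - v @[n --> \oo] --> (0 : X).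
  apply/cvgr0Pnorm_le => eps eps0; near=> n.
  apply: le_trans (xv n) _; near: n.
  move/cvgr0Pnorm_le: tcvg => /(_ _ eps0).
  by apply: filterS => n; apply/le_trans/ler_norm.
apply/cvgr0Pnorm_le => eps eps0.
have eps2 : 0 < eps / 2 by rewrite divr_gt0.
have {}Fo := xv0 _ (Fo _ eps2).
have {}rcvg : \forall n \near \oo, `|r n| <= eps / 2 by exact: cvgr0_norm_le.
near=> n.
have -> : y n - h (y n) = (t n)^-1 *: ((x n - F (x n)) +
    (F (v + (x n - v)) - (F v + h (x n - v)))).
  rewrite /y hpos ?invr_gt0// -scalerBr; congr (_ *: _).
  by rewrite [v + _]addrC subrK addrA subrK Fv opprD addrA.
rewrite normrZ gtr0_norm ?invr_gt0// mulrC ler_pdivrMr//.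
apply: le_trans (ler_normD _ _) _.
rewrite [eps]splitr mulrDl; apply: lerD.
  apply: (le_trans (xF n)); rewrite ler_pM2r//.
  by apply: (le_trans (ler_norm _)); near: n.
apply: (@le_trans _ _ (eps / 2 * `|x n - v|)); first by near: n.
by rewrite ler_pM2l.
Unshelve. all: by end_near. Qed.

Theorem corollary10p5 (R : realType) (X : banachLatticeType R) (e : X)
    (he : AM_unit e) (F : X -> X)
    (hadd : additively_homogeneous e F) (hmon : order_preserving F)
    (v : X) (hv : [set x : X | F x = x] v)
    (F'v : X -> X)
    (A1 : is_semidifferential [set: X] F v F'v)
    (A2 : property_F [set: X] (fun x : X => x - F'v x))
    (A3 : forall x : X, F'v x = x -> [set l *: e | l in [set: R]] x) :
  [set x : X | F x = x] = [set v + l *: e | l in [set: R]].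
Proof.
move: hv => /= Fv; apply/seteqP; split => [w /= Fw|_ [l _ <-]]; last first.
  by rewrite /= hadd Fv.
apply: contrapT => wNv.
have [|c [z0 zinf]] := @AM_normalize _ _ _ he (w - v).
  by case=> l wl; apply: wNv; exists l => //; rewrite -wl addrC subrK.
set z := w - v + c *: e in z0 zinf; pose w' := w + c *: e.
have zE : z = w' - v by rewrite /z /w' addrAC.
have Fw' : F w' = w' by rewrite hadd Fw.
have vw' : v [<=] w' by rewrite -bsubr_ge0 -zE.
pose M := `|z|.
have M0 : 0 < M.
  rewrite lt_def normr_ge0 andbT normr_eq0; apply/eqP => zeq.
  apply: wNv; exists (- c) => //.
  move/eqP: zeq; rewrite addr_eq0 subr_eq => /eqP ->.
  by rewrite scaleNr addrC.
(* Here [r n = 1 / (n + 1)] is both the relative residual and the scale of [t n]; this gives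
   [t n <= M] and a residual [r n * t n = o(t n)]. *)
pose r n : R := harmonic n; pose t n := M * r n.
have r0 n : 0 < r n by exact: harmonic_gt0.
have r1 n : r n <= 1 by rewrite invf_le1 ?ler1n// ltr0n.
have t0 n : 0 < t n by rewrite mulr_gt0.
have tM n : t n <= M by rewrite ler_piMr// ltW.
have wM : w' [<=] v + M *: e by rewrite addrC -ble_subl_addr -zE AM_ble_norm.
have /choice[x xP] : forall n, exists p, [/\ v [<=] p, p [<=] v + t n *: e,
    p [<=] w', w' - (M - t n) *: e [<=] p & `|p - F p| <= r n * t n].
  move=> n; apply: (approximate_fixed_point_between he hadd hmon) => //.
  - by rewrite subr_ge0.
  - exact: ltW.
  - by rewrite subrK.
have xv n : `|x n - v| = t n.
  have [vx xt _ wx _] := xP n; apply/eqP; rewrite eq_le; apply/andP; split.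
    apply: (AM_norm_ge0_le he); rewrite ?(ltW (t0 n)) ?bsubr_ge0//.
    by rewrite ble_subl_addr addrC.
  (* The lower bound [w' - (M - t n) e <= x n] prevents [x n] from being closer to [v] than [t n]:
     taking norms gives [M <= M - t n + |x n - v|]. *)
  have : z [<=] (M - t n + `|x n - v|) *: e.
    rewrite zE [_ - t n + _]addrC scalerDl -ble_subl_addr addrAC.
    apply: (@ble_trans _ _ (x n - v)); first by rewrite bleD2r.
    exact: AM_ble_norm he _.
  move=> /(AM_norm_ge0_le he); rewrite -/M => /(_ _ z0).
  rewrite addr_ge0 ?subr_ge0// => /(_ isT).
  by rewrite -addrA lerDl addrC subr_ge0.
pose y n := (t n)^-1 *: (x n - v).
have yn n : `|y n| = 1.
  by rewrite normrZ xv gtr0_norm ?invr_gt0// mulVf ?gt_eqF.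
have y0 n : 0 [<=] y n.
  have [vx _ _ _ _] := xP n.
  by rewrite ble_scale ?invr_ge0 ?(ltW (t0 n))// bsubr_ge0.
have rcvg : r n @[n --> \oo] --> (0 : R) by exact: cvg_harmonic.
have tcvg : t n @[n --> \oo] --> (0 : R) by rewrite -(mulr0 M); exact: cvgMr.
have ycvg : y n - F'v (y n) @[n --> \oo] --> (0 : X).
  apply: (semidifferential_residual Fv A1 t0 tcvg rcvg) => n; first by rewrite xv.
  by have [] := xP n.
have ybd : bounded_set (range y).
  by exists 1; split => // B B1 _ [n _ <-]; rewrite /= yn ltW.
have [k [kincr yk]] := A2 y (fun=> I) ybd ycvg.
set p := limn (y \o k) in yk.
(* A strictly increasing [k] satisfies [n <= k n]. *)
have koo : k n @[n --> \oo] --> \oo.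
  apply/cvgnyPge => N; exists N => // n /= /leq_trans; apply.
  elim: n => // n /leq_ltn_trans; apply.
  by move/increasing_seqP : kincr; exact.
have pfix : F'v p = p.
  have [_ hcont _ _] := A1.
  apply/esym/eqP; rewrite -subr_eq0; apply/eqP.
  have H1 : y (k n) - F'v (y (k n)) @[n --> \oo] --> p - F'v p.
    apply: cvgB => //; apply: cvg_comp yk _; exact: hcont.
  have H2 : y (k n) - F'v (y (k n)) @[n --> \oo] --> (0 : X).
    exact: cvg_comp koo ycvg.
  exact: cvg_unique H1 H2.
have [l _ pE] := A3 _ pfix.
have p0 : 0 [<=] p.
  have cl : closed (fun q : X => 0 [<=] q) by exact: (closed_ble_ge he).
  by apply: (closed_cvg _ cl _ _ yk); apply: nearW => n; exact: y0.
have p1 : `|p| = 1.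
  have pnorm : `|y (k n)| @[n --> \oo] --> `|p| by exact: cvg_norm yk.
  have : `|y (k n)| @[n --> \oo] --> (1 : R).
    by apply: cvg_near_cst; apply: nearW => n; rewrite yn.
  exact: cvg_unique pnorm.
have l0 : l <= 0.
  (* If [l > 0], some [y (k n)] within [l / 2] of [l e] dominates [(l / 2) e]. Scaling by [t (k n)]
     and using [x (k n) <= w'], a positive multiple of [e] lies below [z], against [zinf]. *)
  rewrite leNgt; apply/negP => l0.
  have l2 : 0 < l / 2 by rewrite divr_gt0.
  move/cvgrPdist_lt: yk => /(_ _ l2)[n _ /(_ _ (leqnn n)) /= pyn].
  have [_ _ xw _ _] := xP (k n).
  apply: (zinf (t (k n) * (l / 2))); first by rewrite mulr_gt0.
  apply: (@ble_trans _ _ (x (k n) - v)); last by rewrite zE bleD2r.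
  have -> : x (k n) - v = t (k n) *: y (k n).
    by rewrite scalerA mulfV ?gt_eqF// scale1r.
  rewrite -scalerA; apply: ble_scale2l; first exact: ltW.
  move: (AM_norm_lt he pyn); rewrite -pE ble_subl_addr addrC -ble_subl_addr.
  by rewrite -scalerBl {1}[l]splitr addrK.
(* Both signs force [p = 0], which contradicts [|p| = 1]. *)
have p_le0 : p [<=] 0 by rewrite -pE -(scale0r e) ble_scale2r// he.1.
have p_eq0 : p = 0 by apply: ble_anti; rewrite p_le0 p0.
by move/eqP: p1; rewrite p_eq0 normr0 eq_sym oner_eq0.
Qed.
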